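(* Let $A\in\mathbb{R}^{N\times N}$ be symmetric positive definite with smallest and largest eigenvalues $\lambda_{\min}$ and $\lambda_{\max}$, let $\mathbf{c}\in\mathbb{R}^N$, and let $X$ be the unique solution of $AX+XA=\mathbf{c}\mathbf{c}^T$. Let $\boldsymbol{\xi}_k=[\xi_1,\dots,\xi_k]\in\mathbb{C}^k$ be a list of poles closed under complex conjugation such that none of the $\xi_i$ lies in $[\lambda_{\min},\lambda_{\max}]$. Let $X_{\mathtt{lan}}$ be the approximation returned by the Lanczos method after $M$ iterations and $X_{\mathtt{ref}}$ the approximation returned by the reference method with $M$ Lanczos iterations and poles $\boldsymbol{\xi}_k$ (both defined in the context). Then $$\|X-X_{\mathtt{ref}}\|_F\le \|X-X_{\mathtt{lan}}\|_F+\frac{h(\boldsymbol{\xi}_k,\lambda_{\min},\lambda_{\max})}{\lambda_{\min}}\,\|\mathbf{c}\|_2^2,$$ where $$h(\boldsymbol{\xi}_k,a,b):=\max_{z\in[a,b]}\frac{\prod_{i=1}^k|z+\bar\xi_i|^2}{\prod_{i=1}^k|z-\xi_i|^2}.$$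
   Context: All computations are in exact arithmetic. $\mathbf{e}_j$ denotes the $j$th unit vector of appropriate size. Lanczos process: $\beta_0=0$, $\mathbf{q}_0=0$, $\mathbf{q}_1=\mathbf{c}/\|\mathbf{c}\|_2$, and for $j=1,\dots,M$: $\mathbf{w}=A\mathbf{q}_j-\beta_{j-1}\mathbf{q}_{j-1}$, $\alpha_j=\mathbf{q}_j^T\mathbf{w}$, $\mathbf{w}\leftarrow\mathbf{w}-\alpha_j\mathbf{q}_j$, $\beta_j=\|\mathbf{w}\|_2$, $\mathbf{q}_{j+1}=\mathbf{w}/\beta_j$. It is assumed throughout that $M<N$ and that no breakdown occurs. Then $\mathbf{Q}_M=[\mathbf{q}_1,\dots,\mathbf{q}_M]$ is an orthonormal basis of the Krylov subspace $\mathrm{span}\{\mathbf{c},A\mathbf{c},\dots,A^{M-1}\mathbf{c}\}$, and $\mathbf{T}_M=\mathbf{Q}_M^TA\mathbf{Q}_M$ is the symmetric tridiagonal $M\times M$ matrix with diagonal $\alpha_1,\dots,\alpha_M$ and off-diagonal $\beta_1,\dots,\beta_{M-1}$. Lanczos method: $X_{\mathtt{lan}}=\mathbf{Q}_MX_M\mathbf{Q}_M^T$, where $X_M$ is the unique solution of $\mathbf{T}_MX_M+X_M\mathbf{T}_M=\|\mathbf{c}\|_2^2\,\mathbf{e}_1\mathbf{e}_1^T$. Rational Krylov subspace: for $S\in\mathbb{R}^{M\times M}$ having no eigenvalue among the poles and $\mathbf{b}\in\mathbb{R}^M$, $\mathcal{Q}(S,\mathbf{b},\boldsymbol{\xi}_k)=\{p(S)q(S)^{-1}\mathbf{b}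 : p\in\mathcal{P}_{k-1}\}$, where $q(z)=(z-\xi_1)\cdots(z-\xi_k)$ and $\mathcal{P}_{k-1}$ is the set of real polynomials of degree at most $k-1$. It is assumed throughout that this subspace has dimension $k$. Reference method: let $\mathbf{U}_{M,k}\in\mathbb{R}^{M\times k}$ have orthonormal columns spanning $\mathcal{Q}(\mathbf{T}_M,\mathbf{e}_1,\boldsymbol{\xi}_k)$, let $Y_{M,k}$ be the unique solution of $$\mathbf{U}_{M,k}^T\mathbf{T}_M\mathbf{U}_{M,k}Y_{M,k}+Y_{M,k}\mathbf{U}_{M,k}^T\mathbf{T}_M\mathbf{U}_{M,k}=\|\mathbf{c}\|_2^2(\mathbf{U}_{M,k}^T\mathbf{e}_1)(\mathbf{U}_{M,k}^T\mathbf{e}_1)^T,$$ and set $X_{\mathtt{ref}}=(\mathbf{Q}_M\mathbf{U}_{M,k})Y_{M,k}(\mathbf{Q}_M\mathbf{U}_{M,k})^T$. *)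

(* Defs.v *)
From mathcomp Require Import all_boot all_order all_algebra complex.
From mathcomp Require Import boolp classical_sets reals topology normedtype derive.

Set Implicit Arguments.
Unset Strict Implicit.
Unset Printing Implicit Defensive.

Import Order.TTheory GRing.Theory Num.Theory numFieldNormedType.Exports.
Import ComplexField.Normc.

Local Open Scope classical_set_scope.
Local Open Scope complex_scope.
Local Open Scope ring_scope.

(* The library norm [`|A|] of a matrix is the entrywise maximum.  The Frobenius
   norm of a one-column matrix is its Euclidean norm. *)
Definition frobenius (R : realType) (m n : nat) (A : 'M[R]_(m, n)) : R :=
  Num.sqrt (\sum_i \sum_j A i j ^+ 2).

Definition norm2 (R : realType) (n : nat) (v : 'cV[R]_n) : R := frobenius v.

Definition posdefmx (R : realType) (n : nat) (A : 'M[R]_n) : Prop :=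
  A^T = A /\ forall v : 'cV[R]_n, v != 0 -> 0 < (v^T *m A *m v) 0 0.

Definition smallest_eigenvalue (R : realType) (n : nat) (A : 'M[R]_n) (a : R) :
  Prop := eigenvalue A a /\ forall b, eigenvalue A b -> a <= b.

Definition largest_eigenvalue (R : realType) (n : nat) (A : 'M[R]_n) (a : R) :
  Prop := eigenvalue A a /\ forall b, eigenvalue A b -> b <= a.

Definition lyapunov_solution (R : realType) (n : nat) (A B X : 'M[R]_n) : Prop :=
  A *m X + X *m A = B.

(* Lanczos process.  The state after [j] steps is [(q_j, q_(j+1), beta_j)]. *)
Definition lanczos_step (R : realType) (N : nat) (A : 'M[R]_N)
    (s : 'cV[R]_N * 'cV[R]_N * R) : 'cV[R]_N * 'cV[R]_N * R :=
  let: (qprev, q, betaprev) := s in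
  let w := A *m q - betaprev *: qprev in
  let alpha := (q^T *m w) 0 0 in
  let w' := w - alpha *: q in
  let beta := norm2 w' in
  (q, beta^-1 *: w', beta).

Definition lanczos_state (R : realType) (N : nat) (A : 'M[R]_N) (c : 'cV[R]_N)
    (j : nat) : 'cV[R]_N * 'cV[R]_N * R :=
  iter j (lanczos_step A) (0, (norm2 c)^-1 *: c, 0).

Definition lanczos_q (R : realType) (N : nat) (A : 'M[R]_N) (c : 'cV[R]_N)
    (j : nat) : 'cV[R]_N := (lanczos_state A c j).1.1.

Definition lanczos_beta (R : realType) (N : nat) (A : 'M[R]_N) (c : 'cV[R]_N)
    (j : nat) : R := (lanczos_state A c j).2.

(* No division by zero in the first [M] steps, normalisation of [c] included. *)
Definition no_breakdown (R : realType) (N : nat) (A : 'M[R]_N) (c : 'cV[R]_N)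
    (M : nat) : Prop :=
  norm2 c != 0 /\
  forall j : nat, (1 <= j <= M)%N -> lanczos_beta A c j != 0.

(* Columns are numbered from 0 here: column [j] is [q_(j+1)]. *)
Definition lanczosQ (R : realType) (N : nat) (A : 'M[R]_N) (c : 'cV[R]_N)
    (M : nat) : 'M[R]_(N, M) :=
  \matrix_(i, j) lanczos_q A c j.+1 i 0.

Definition lanczosT (R : realType) (N : nat) (A : 'M[R]_N) (c : 'cV[R]_N)
    (M : nat) : 'M[R]_M :=
  (lanczosQ A c M)^T *m A *m lanczosQ A c M.

Definition e1 (R : realType) (m : nat) : 'cV[R]_m.+1 := delta_mx ord0 ord0.

(* [m.+1] is the number [M] of Lanczos iterations. *)
Definition lanczos_approx (R : realType) (N : nat) (A : 'M[R]_N) (c : 'cV[R]_N)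
    (m : nat) (Xlan : 'M[R]_N) : Prop :=
  let Q := lanczosQ A c m.+1 in
  let T := lanczosT A c m.+1 in
  exists XM : 'M[R]_m.+1,
    lyapunov_solution T (norm2 c ^+ 2 *: (e1 R m *m (e1 R m)^T)) XM /\
    Xlan = Q *m XM *m Q^T.

(* Multiplicities count: the list of conjugates is a rearrangement of the list. *)
Definition conj_closed (R : realType) (xi : seq R[i]) : Prop :=
  perm_eq [seq conjc z | z <- xi] xi.

Definition pole_poly (R : realType) (xi : seq R[i]) : {poly R[i]} :=
  \prod_(z <- xi) ('X - z%:P).

(* The equation [v = p(S) q(S)^-1 b] is read in complex matrices, where [q] has
   its coefficients; the vector [v] itself is real, and so is [p].  The bound
   [size p <= k] says that [p] has degree at most [k - 1]. *)
Definition rational_krylov (R : realType) (m : nat) (S : 'M[R]_m.+1)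
    (b : 'cV[R]_m.+1) (xi : seq R[i]) : set 'cV[R]_m.+1 :=
  let cx := real_complex R in
  let SC := map_mx cx S in
  [set v | exists p : {poly R}, (size p <= size xi)%N /\
     map_mx cx v =
       horner_mx SC (map_poly cx p) *m invmx (horner_mx SC (pole_poly xi))
         *m map_mx cx b].

Definition orthonormal_basis (R : realType) (n k : nat) (U : 'M[R]_(n, k))
    (V : set 'cV[R]_n) : Prop :=
  U^T *m U = 1%:M /\ V = [set U *m y | y in [set: 'cV[R]_k]].

Definition reference_approx (R : realType) (N : nat) (A : 'M[R]_N)
    (c : 'cV[R]_N) (m k : nat) (xi : k.-tuple R[i]) (Xref : 'M[R]_N) : Prop :=
  let Q := lanczosQ A c m.+1 in
  let T := lanczosT A c m.+1 in
  exists (U : 'M[R]_(m.+1, k)) (Y : 'M[R]_k),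
    [/\ orthonormal_basis U (rational_krylov T (e1 R m) xi),
        lyapunov_solution (U^T *m T *m U)
          (norm2 c ^+ 2 *: ((U^T *m e1 R m) *m (U^T *m e1 R m)^T)) Y
      & Xref = (Q *m U) *m Y *m (Q *m U)^T].

Definition h_ratio (R : realType) (xi : seq R[i]) (z : R) : R :=
  (\prod_(x <- xi) normc (z%:C + conjc x) ^+ 2) /
  (\prod_(x <- xi) normc (z%:C - x) ^+ 2).

Definition h (R : realType) (xi : seq R[i]) (a b : R) : R :=
  sup [set h_ratio xi z | z in `[a, b]].

Lemma normc_sqr (R : realType) (x : R[i]) :
  normc x ^+ 2 = complex.Re x ^+ 2 + complex.Im x ^+ 2.
Proof. by case: x => u v /=; rewrite sqr_sqrtr // addr_ge0 // sqr_ge0. Qed.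

Lemma continuous_prod_seq (R : realType) (f : R[i] -> R -> R) (xi : seq R[i]) :
  (forall x, continuous (f x)) -> continuous (fun z => \prod_(x <- xi) f x z).
Proof.
move=> cf; elim: xi => [|x s IH] z.
  under eq_fun do rewrite big_nil.
  exact: cst_continuous.
under eq_fun do rewrite big_cons.
by apply: continuousM; [exact: cf|exact: IH].
Qed.

(* The supremum defining [h] is a maximum when no pole lies in the interval. *)
Lemma h_max (R : realType) (xi : seq R[i]) (a b : R) : a <= b ->
  (forall t : R, a <= t <= b -> t%:C \notin xi) ->
  (exists2 z, a <= z <= b & h xi a b = h_ratio xi z) /\
  (forall z, a <= z <= b -> h_ratio xi z <= h xi a b).
Proof.
move=> ab nxi.
have cquad (u v : R) (w : R -> R) : continuous w ->
    continuous (fun z : R => w z ^+ 2 + v ^+ 2).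
  move=> cw z; apply: cvgD; last exact: cvg_cst.
  by under eq_fun do rewrite expr2; apply: cvgM; exact: cw.
have cnum : continuous (fun z : R => \prod_(x <- xi) normc (z%:C + conjc x) ^+ 2).
  apply: continuous_prod_seq => -[u v] z.
  under eq_fun do rewrite normc_sqr /= add0r.
  apply: (cquad u (- v) (fun z => z + u)) => t.
  by apply: cvgD; [exact: cvg_id|exact: cvg_cst].
have cden : continuous (fun z : R => \prod_(x <- xi) normc (z%:C - x) ^+ 2).
  apply: continuous_prod_seq => -[u v] z.
  under eq_fun do rewrite normc_sqr /= add0r.
  apply: (cquad u (- v) (fun z => z - u)) => t.
  by apply: cvgD; [exact: cvg_id|exact: cvg_cst].
have ch : {within `[a, b], continuous (h_ratio xi)}.
  apply: continuous_in_subspaceT => z; rewrite inE /= in_itv /= => zab.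
  apply: cvgM; first exact: cnum.
  apply: cvgV; last exact: cden.
  rewrite prodf_seq_neq0; apply/allP => x xxi; rewrite expf_eq0 /=.
  apply: contra (nxi z zab) => /eqP/eq0_normc/eqP.
  by rewrite subr_eq0 => /eqP->.
have [z zab zmax] := EVT_max ab ch.
have hz : h xi a b = h_ratio xi z.
  apply/eqP; rewrite eq_le; apply/andP; split.
    apply: ge_sup; first by exists (h_ratio xi z), z.
    by move=> _ [t tab <-]; exact: zmax.
  apply: ub_le_sup; last by exists z.
  by exists (h_ratio xi z) => _ [t tab <-]; exact: zmax.
split; first by exists z; [move: zab; rewrite in_itv|].
by move=> t tab; rewrite hz; apply: zmax; rewrite in_itv.
Qed.

(* Main.v *)
Require Import Defs.
From mathcomp Require Import all_boot all_order all_algebra complex.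
From mathcomp Require Import boolp classical_sets reals.
From mathcomp Require Import ring lra.

Set Implicit Arguments.
Unset Strict Implicit.
Unset Printing Implicit Defensive.

Import Order.TTheory GRing.Theory Num.Theory.
Import ComplexField.Normc.

Local Open Scope complex_scope.
Local Open Scope ring_scope.

(** With [Q] the Lanczos basis, [T = Q^T A Q] and [L Z = T Z + Z T], both
    approximations are [Q _ Q^T] of small matrices: [Z], the exact solution of
    [L Z = |c|^2 e1 e1^T], and its Galerkin approximation [U Y U^T].  Since [Q]
    has orthonormal columns ([lanczosQ_orthonormal]), the triangle inequality
    reduces the claim to [|E| <= (h / lmin) |c|^2] for [E = Z - U Y U^T].

    The operator [L] is self-adjoint for the Frobenius product and bounded below
    by [2 lmin], because the spectrum of [T] lies in [[lmin, lmax]]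
    ([projected_eigenvalue]).  The Galerkin condition makes [L E] orthogonal to
    every [U W U^T], so [E] may be replaced by any trial error [F = Z - U W U^T]
    in one slot: [<E, L E> = <F, L E> = <L F, E>].  By Cauchy-Schwarz, [|E|] is
    at most the norm of the residual of any trial solution divided by [2 lmin]
    ([galerkin_error]).

    A good trial solution comes from the Blaschke-like quotient
    [r(z) = q(-z) / q(z)], where [q] is the pole polynomial.  The polynomial
    [q(x) q(y) - q(-x) q(-y)] vanishes on [x + y = 0]; its quotient by [x + y]
    has degree at most [k - 1] in each variable, hence defines a [U W U^T], and
    the residual of the latter is [|c|^2 s s^T] with [s = r(T) e1]
    ([trial_image_rank1]).  Finally [|s s^T| = |s|^2], and [|r|^2] is the ratio
    maximised by [h] (the poles being closed under conjugation, [q] is real), so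
    [|s|^2 <= h] by the spectral theorem ([pole_quotient_bound]).  This gives
    [h / (2 lmin)]. *)

(** * The Frobenius product *)

Definition mxdot (R : realType) (m n : nat) (X Y : 'M[R]_(m, n)) : R :=
  \tr (X^T *m Y).

Section FrobeniusProduct.
Context {R : realType}.
Implicit Types (m n p : nat).

Lemma mxdotE m n (X Y : 'M[R]_(m, n)) : mxdot X Y = \sum_i \sum_j X i j * Y i j.
Proof.
rewrite /mxdot /mxtrace exchange_big; apply: eq_bigr => j _.
by rewrite mxE; apply: eq_bigr => i _; rewrite mxE.
Qed.

Lemma mxdotC m n (X Y : 'M[R]_(m, n)) : mxdot X Y = mxdot Y X.
Proof. by rewrite /mxdot -mxtrace_tr trmx_mul trmxK. Qed.

Lemma mxdotDr m n (X Y Z : 'M[R]_(m, n)) :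
  mxdot X (Y + Z) = mxdot X Y + mxdot X Z.
Proof. by rewrite /mxdot mulmxDr mxtraceD. Qed.

Lemma mxdotBr m n (X Y Z : 'M[R]_(m, n)) :
  mxdot X (Y - Z) = mxdot X Y - mxdot X Z.
Proof. by rewrite /mxdot mulmxBr raddfB. Qed.

Lemma mxdotZr m n a (X Y : 'M[R]_(m, n)) : mxdot X (a *: Y) = a * mxdot X Y.
Proof. by rewrite /mxdot -scalemxAr mxtraceZ. Qed.

Lemma mxdot0r m n (X : 'M[R]_(m, n)) : mxdot X 0 = 0.
Proof. by rewrite /mxdot mulmx0 mxtrace0. Qed.

Lemma mxdotDl m n (X Y Z : 'M[R]_(m, n)) :
  mxdot (X + Y) Z = mxdot X Z + mxdot Y Z.
Proof. by rewrite !(mxdotC _ Z) mxdotDr. Qed.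

Lemma mxdotBl m n (X Y Z : 'M[R]_(m, n)) :
  mxdot (X - Y) Z = mxdot X Z - mxdot Y Z.
Proof. by rewrite !(mxdotC _ Z) mxdotBr. Qed.

Lemma mxdotZl m n a (X Y : 'M[R]_(m, n)) : mxdot (a *: X) Y = a * mxdot X Y.
Proof. by rewrite !(mxdotC _ Y) mxdotZr. Qed.

Lemma mxdot_adjl m n p (A : 'M[R]_(m, n)) (X : 'M_(m, p)) (Y : 'M_(n, p)) :
  mxdot X (A *m Y) = mxdot (A^T *m X) Y.
Proof. by rewrite /mxdot trmx_mul trmxK mulmxA. Qed.

Lemma mxdot_adjr m n p (A : 'M[R]_(n, p)) (X : 'M_(m, p)) (Y : 'M_(m, n)) :
  mxdot X (Y *m A) = mxdot (X *m A^T) Y.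
Proof. by rewrite /mxdot trmx_mul trmxK mulmxA mxtrace_mulC mulmxA. Qed.

Lemma mxdot_ge0 m n (X : 'M[R]_(m, n)) : 0 <= mxdot X X.
Proof.
rewrite mxdotE; apply: sumr_ge0 => i _; apply: sumr_ge0 => j _.
by rewrite -expr2 sqr_ge0.
Qed.

Lemma mxdot_eq0 m n (X : 'M[R]_(m, n)) : (mxdot X X == 0) = (X == 0).
Proof.
apply/eqP/eqP => [|->]; last by rewrite mxdot0r.
rewrite mxdotE => /eqP; rewrite psumr_eq0 => [/allP H|i _]; last first.
  by apply: sumr_ge0 => j _; rewrite -expr2 sqr_ge0.
apply/matrixP => i j; rewrite mxE; move: (H i (mem_index_enum i)) => /=.
rewrite psumr_eq0 => [/allP/(_ j (mem_index_enum j)) /=|k _]; last first.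
  by rewrite -expr2 sqr_ge0.
by rewrite mulf_eq0 orbb => /eqP.
Qed.

Lemma mxdot_col m n (X Y : 'M[R]_(m, n)) :
  mxdot X Y = \sum_j mxdot (col j X) (col j Y).
Proof.
rewrite mxdotE exchange_big; apply: eq_bigr => j _ /=.
rewrite mxdotE; apply: eq_bigr => i _.
by rewrite big_ord_recl big_ord0 addr0 !mxE.
Qed.

Lemma mxdot_cV n (x y : 'cV[R]_n) : mxdot x y = (x^T *m y) 0 0.
Proof. exact: trace_mx11. Qed.

Lemma frobenius_sqr m n (X : 'M[R]_(m, n)) : frobenius X ^+ 2 = mxdot X X.
Proof.
rewrite /frobenius sqr_sqrtr; last first.
  by apply: sumr_ge0 => i _; apply: sumr_ge0 => j _; rewrite sqr_ge0.
by rewrite mxdotE; under eq_bigr do under eq_bigr do rewrite expr2.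
Qed.

Lemma frobenius_ge0 m n (X : 'M[R]_(m, n)) : 0 <= frobenius X.
Proof. exact: sqrtr_ge0. Qed.

Lemma frobeniusE m n (X : 'M[R]_(m, n)) : frobenius X = Num.sqrt (mxdot X X).
Proof. by rewrite -frobenius_sqr sqrtr_sqr ger0_norm ?frobenius_ge0. Qed.

(** The Cauchy-Schwarz inequality. *)
Lemma mxdot_le_frobenius m n (X Y : 'M[R]_(m, n)) :
  mxdot X Y <= frobenius X * frobenius Y.
Proof.
have [->|Y0] := eqVneq Y 0.
  by rewrite mxdot0r mulr_ge0 ?frobenius_ge0.
have Yp : 0 < mxdot Y Y by rewrite lt0r mxdot_eq0 Y0 mxdot_ge0.
(* Up to the factor [mxdot Y Y], the part of [X] orthogonal to [Y]. *)
have := mxdot_ge0 (mxdot Y Y *: X - mxdot X Y *: Y).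
rewrite !(mxdotBl, mxdotBr, mxdotZl, mxdotZr) (mxdotC Y X) => H.
have {}H : 0 <= mxdot Y Y * (mxdot X X * mxdot Y Y - mxdot X Y ^+ 2).
  by apply: le_trans H _; rewrite le_eqVlt; apply/orP; left; apply/eqP; ring.
move: H; rewrite pmulr_rge0 // subr_ge0 -!frobenius_sqr -exprMn => H.
apply: le_trans (ler_norm _) _.
rewrite -[leRHS]ger0_norm ?mulr_ge0 ?frobenius_ge0 //.
by rewrite -ler_sqr ?nnegrE // ?real_normK ?num_real.
Qed.

Lemma frobeniusZ m n a (X : 'M[R]_(m, n)) :
  0 <= a -> frobenius (a *: X) = a * frobenius X.
Proof.
move=> a0; rewrite !frobeniusE mxdotZl mxdotZr mulrA -expr2.
by rewrite sqrtrM ?sqr_ge0 // sqrtr_sqr ger0_norm.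
Qed.

Lemma frobeniusD m n (X Y : 'M[R]_(m, n)) :
  frobenius (X + Y) <= frobenius X + frobenius Y.
Proof.
rewrite -ler_sqr ?nnegrE ?addr_ge0 ?frobenius_ge0 // sqrrD !frobenius_sqr.
rewrite mxdotDl !mxdotDr (mxdotC Y X).
have := mxdot_le_frobenius X Y; lra.
Qed.

Lemma frobenius_isometry n p (Q : 'M[R]_(n, p)) (E : 'M_p) :
  Q^T *m Q = 1%:M -> frobenius (Q *m E *m Q^T) = frobenius E.
Proof.
move=> QQ; rewrite !frobeniusE; congr Num.sqrt.
rewrite mxdot_adjr trmxK -!mulmxA QQ mulmx1 mxdot_adjl mulmxA QQ mul1mx.
by [].
Qed.

Lemma frobenius_rank1 n (s : 'cV[R]_n) : frobenius (s *m s^T) = mxdot s s.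
Proof.
rewrite frobeniusE mxdot_adjr trmxK mxdotC -mulmxA (mx11_scalar (s^T *m s)).
rewrite -mxdot_cV mul_mx_scalar mxdotZr.
by rewrite -expr2 sqrtr_sqr ger0_norm // mxdot_ge0.
Qed.

End FrobeniusProduct.

(** * Galerkin error of a Lyapunov equation *)

Section Galerkin.
Context {R : realType}.

Definition lyap n (T Z : 'M[R]_n) := T *m Z + Z *m T.

Lemma lyapD n (T Z1 Z2 : 'M[R]_n) : lyap T (Z1 + Z2) = lyap T Z1 + lyap T Z2.
Proof. by rewrite /lyap mulmxDl mulmxDr addrACA. Qed.

Lemma lyapZ n (T : 'M[R]_n) a Z : lyap T (a *: Z) = a *: lyap T Z.
Proof. by rewrite /lyap -scalemxAl -scalemxAr scalerDr. Qed.

Lemma lyapB n (T Z1 Z2 : 'M[R]_n) : lyap T (Z1 - Z2) = lyap T Z1 - lyap T Z2.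
Proof. by rewrite lyapD -scaleN1r lyapZ scaleN1r. Qed.

Lemma lyap_sym n (T X Y : 'M[R]_n) : T^T = T ->
  mxdot (lyap T X) Y = mxdot X (lyap T Y).
Proof.
by move=> TT; rewrite /lyap mxdotDl mxdotDr mxdot_adjl mxdot_adjr TT.
Qed.

Definition rayleigh_lb n (T : 'M[R]_n) (l : R) :=
  forall x : 'cV_n, l * mxdot x x <= mxdot x (T *m x).

Lemma rayleigh_lb_mx n p (T : 'M[R]_n) (l : R) (E : 'M_(n, p)) :
  rayleigh_lb T l -> l * mxdot E E <= mxdot E (T *m E).
Proof.
move=> H; rewrite !mxdot_col mulr_sumr; apply: ler_sum => j _.
by rewrite (colE _ (_ *m _)) -mulmxA -colE; exact: H.
Qed.

(** Each of the two terms of [lyap T E] contributes [l]: the second is the first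
    for the transpose of [E]. *)
Lemma lyap_coercive n (T E : 'M[R]_n) l : T^T = T -> rayleigh_lb T l ->
  2 * l * mxdot E E <= mxdot E (lyap T E).
Proof.
move=> TT H; rewrite /lyap mxdotDr.
have H1 := rayleigh_lb_mx E H.
have := rayleigh_lb_mx E^T H.
have -> : mxdot E^T E^T = mxdot E E by rewrite /mxdot trmxK mxtrace_mulC.
have -> : mxdot E^T (T *m E^T) = mxdot E (E *m T).
  by rewrite /mxdot trmxK mxtrace_mulC -mulmxA mxtrace_mulC mulmxA.
lra.
Qed.

(** Galerkin orthogonality lets one copy of the error in [<E, L E>] be traded
    for the error of an arbitrary trial solution [U W U^T], which [L] maps to the
    residual [S]; coercivity of [L] then bounds the error by [S]. *)
Lemma galerkin_error n k (T Z B S : 'M[R]_n) (U : 'M_(n, k)) (Y W : 'M_k) l :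
  T^T = T -> 0 < l -> rayleigh_lb T l -> U^T *m U = 1%:M ->
  lyap T Z = B -> lyap (U^T *m T *m U) Y = U^T *m B *m U ->
  lyap T (U *m W *m U^T) = B - S ->
  frobenius (Z - U *m Y *m U^T) <= frobenius S / (2 * l).
Proof.
move=> TT l0 Tl UU ZB YB WB; set E := Z - _.
have orth V : mxdot (lyap T E) (U *m V *m U^T) = 0.
  rewrite mxdot_adjr trmxK mxdot_adjl lyapB ZB.
  suff -> : U^T *m ((B - lyap T (U *m Y *m U^T)) *m U) = 0.
    by rewrite mxdotC mxdot0r.
  rewrite mulmxBl mulmxBr mulmxA -YB /lyap mulmxDl mulmxDr -!mulmxA UU mulmx1.
  by rewrite !mulmxA UU mul1mx subrr.
have EF : E = (Z - U *m W *m U^T) + U *m (W - Y) *m U^T.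
  by rewrite mulmxBr mulmxBl addrA subrK.
have ES : mxdot E (lyap T E) = mxdot E S.
  rewrite -lyap_sym // {2}EF mxdotDr orth addr0 lyap_sym //.
  by rewrite lyapB ZB WB opprB addrC subrK.
have := lyap_coercive E TT Tl; rewrite ES => H.
have {}H := le_trans H (mxdot_le_frobenius E S).
have [E0|E0] := eqVneq (frobenius E) 0.
  by rewrite E0 divr_ge0 ?frobenius_ge0 // mulr_ge0 // ltW.
have Ep : 0 < frobenius E by rewrite lt0r E0 frobenius_ge0.
rewrite ler_pdivlMr ?mulr_gt0 // -(ler_pM2l Ep) mulrA -expr2 frobenius_sqr.
by rewrite mulrC.
Qed.

End Galerkin.

(** * Trial solutions built from a Krylov sequence *)

Definition sym_outer (R : realType) n (x y : 'cV[R]_n) := x *m y^T + y *m x^T.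

Section TrialSpace.
Context {R : realType} {n k : nat}.
Variables (T : 'M[R]_n) (U : 'M[R]_(n, k)) (v : nat -> 'cV[R]_n).

(** The right-hand sides solved exactly by some matrix with row and column
    spaces in the range of [U]. *)
Definition trial_image (B : 'M[R]_n) :=
  exists W : 'M_k, lyap T (U *m W *m U^T) = B.

Lemma trial_image0 : trial_image 0.
Proof. by exists 0; rewrite mulmx0 mul0mx /lyap mulmx0 mul0mx addr0. Qed.

Lemma trial_imageD B1 B2 :
  trial_image B1 -> trial_image B2 -> trial_image (B1 + B2).
Proof.
by move=> [W1 <-] [W2 <-]; exists (W1 + W2); rewrite mulmxDr mulmxDl lyapD.
Qed.

Lemma trial_imageZ a B : trial_image B -> trial_image (a *: B).
Proof.
by move=> [W <-]; exists (a *: W); rewrite -scalemxAr -scalemxAl lyapZ.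
Qed.

Lemma trial_image_sum (I : finType) (F : I -> 'M[R]_n) :
  (forall i, trial_image (F i)) -> trial_image (\sum_i F i).
Proof.
move=> HF; apply: big_ind => //; first exact: trial_image0.
exact: trial_imageD.
Qed.

Hypothesis T_sym : T^T = T.
Hypothesis vS : forall i, T *m v i = v i.+1.
Hypothesis vU : forall i, (i < k)%N -> exists y, v i = U *m y.

Let vTS i : (v i)^T *m T = (v i.+1)^T.
Proof. by rewrite -(vS i) [in RHS]trmx_mul T_sym. Qed.

(** The polynomial [x^i y^j + x^j y^i] is divisible by [x + y] when [j - i] is
    odd.  The division is carried out by moving the exponents towards each
    other: [L (v_i v_(j-1)^T + v_(j-1) v_i^T)] is the required matrix plus the
    one for [(i + 1, j - 1)], and for [j = i + 1] one has
    [L (v_i v_i^T) = v_(i+1) v_i^T + v_i v_(i+1)^T]. *)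
Lemma trial_image_odd d i : (i + d.*2.+1 <= k)%N ->
  trial_image (sym_outer (v i) (v (i + d.*2.+1))).
Proof.
elim: d i => [|d IH] i lek.
  have [|y hy] := vU (i := i); first by rewrite -addn1.
  exists (y *m y^T); rewrite mulmxA -mulmxA -trmx_mul -hy.
  by rewrite /lyap mulmxA vS -mulmxA vTS addn1 addrC.
have eqS : (i + d.+1.*2.+1 = (i.+1 + d.*2.+1).+1)%N.
  by rewrite doubleS !addnS !addSn.
rewrite eqS in lek *.
have [|y hy] := vU (i := i).
  by apply: leq_trans lek; rewrite addSn ltnS leqW // leq_addr.
have [//|z hz] := vU (i := i.+1 + d.*2.+1).
have -> : sym_outer (v i) (v (i.+1 + d.*2.+1).+1) =
    lyap T (sym_outer (v i) (v (i.+1 + d.*2.+1)))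
    + (-1) *: sym_outer (v i.+1) (v (i.+1 + d.*2.+1)).
  rewrite /lyap /sym_outer mulmxDl mulmxDr !mulmxA !vS -!mulmxA !vTS.
  apply/matrixP => r s; move: (v i.+1 *m _) (_ *m (v i.+1)^T) => P1 P2.
  by rewrite !mxE; ring.
apply: trial_imageD; last first.
  by apply/trial_imageZ/IH/ltnW.
have -> : sym_outer (v i) (v (i.+1 + d.*2.+1)) = U *m sym_outer y z *m U^T.
  rewrite /sym_outer mulmxDr mulmxDl !mulmxA -hy -hz -!mulmxA -!trmx_mul.
  by rewrite -hy -hz.
by exists (sym_outer y z).
Qed.

Let g (a : nat -> R) := \sum_(i < k.+1) a i *: v i.

(** Replacing [a i] by [(-1)^i a i] keeps the products [a i * a j] with [i + j]
    even and negates the others, so only the pairs covered by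
    [trial_image_odd] survive in the difference. *)
Lemma trial_image_parity (a : nat -> R) :
  trial_image (g a *m (g a)^T -
    g (fun i => (-1) ^+ i * a i) *m (g (fun i => (-1) ^+ i * a i))^T).
Proof.
(* Symmetrised in [i] and [j], as divisibility by [x + y] requires. *)
have gg b : g b *m (g b)^T =
    2^-1 *: \sum_(i < k.+1) \sum_(j < k.+1)
      (b i * b j) *: sym_outer (v i) (v j).
  apply: (scalerI (a := 2)); first by rewrite pnatr_eq0.
  rewrite scalerA divff ?pnatr_eq0 // scale1r /sym_outer.
  transitivity (g b *m (g b)^T + g b *m (g b)^T).
    by rewrite scaler_nat mulr2n.
  have -> : g b *m (g b)^T =
      \sum_(i < k.+1) \sum_(j < k.+1) (b i * b j) *: (v i *m (v j)^T).
    rewrite /g mulmx_suml; apply: eq_bigr => i _.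
    rewrite linear_sum mulmx_sumr; apply: eq_bigr => j _.
    by rewrite linearZ /= -scalemxAl -scalemxAr scalerA.
  rewrite {2}exchange_big -big_split /=; apply: eq_bigr => i _.
  rewrite -big_split /=; apply: eq_bigr => j _.
  by rewrite scalerDr (mulrC (b j)).
rewrite !gg -scalerBr; apply: trial_imageZ.
rewrite -sumrB; apply: trial_image_sum => i.
rewrite -sumrB; apply: trial_image_sum => j.
rewrite -scalerBl mulrACA -exprD -{1}[a i * a j]mul1r -mulrBl.
rewrite -signr_odd; case: (boolP (odd (i + j))) => oij; last first.
  by rewrite subrr mul0r scale0r; exact: trial_image0.
apply: trial_imageZ.
wlog lt_ij : i j oij / (i < j)%N => [H|].
  have [|lt_ji|eij] := ltngtP i j; first exact: H.
    by rewrite /sym_outer addrC; apply: H => //; rewrite addnC.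
  by move: oij; rewrite eij addnn odd_double.
have odji : odd (j - i) by rewrite oddB ?(ltnW lt_ij) // addbC -oddD.
have ej : (i + (j - i)./2.*2.+1 = j)%N.
  have := odd_double_half (j - i); rewrite odji add1n => ->.
  by rewrite subnKC // ltnW.
by rewrite -ej; apply: trial_image_odd; rewrite ej -ltnS.
Qed.

End TrialSpace.

Lemma coef_comp_polyNX (R : comNzRingType) (f : {poly R}) i :
  (f \Po (- 'X))`_i = (-1) ^+ i * f`_i.
Proof.
rewrite coef_comp_poly -scaleN1r.
under eq_bigr => j _ do rewrite exprZn coefZ coefXn.
have [lt_i|le_i] := ltnP i (size f); last first.
  rewrite nth_default // mulr0 big1 // => j _.
  by rewrite gtn_eqF ?mulr0 // (leq_trans _ le_i).
rewrite (bigD1 (Ordinal lt_i)) //= eqxx mulr1 mulrC big1 ?addr0 // => j.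
by rewrite -val_eqE /= eq_sym => /negPf->; rewrite !mulr0.
Qed.

Lemma horner_mx_wide (R : comNzRingType) n (T : 'M[R]_n.+1) (f : {poly R}) k :
  (size f <= k)%N -> horner_mx T f = \sum_(i < k) f`_i *: T ^+ i.
Proof.
move=> sf; have {1}-> : f = \sum_(i < k) f`_i *: 'X^i.
  rewrite -poly_def; apply/polyP => i; rewrite coef_poly.
  by case: ltnP => // /(leq_trans sf)/leq_sizeP->.
rewrite rmorph_sum; apply: eq_bigr => i _ /=.
by rewrite horner_mxZ rmorphXn /= horner_mx_X.
Qed.

(** The matrix form of the divisibility of [f(x) f(y) - f(-x) f(-y)] by [x + y],
    with a quotient of degree less than [k] in each variable. *)
Lemma trial_image_rank1 (R : realType) n k (T : 'M[R]_n.+1)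
    (U : 'M_(n.+1, k)) (u : 'cV_n.+1) (f : {poly R})
    (s := horner_mx T f *m u) (s' := horner_mx T (f \Po (- 'X)) *m u) :
  T^T = T -> (forall i, (i < k)%N -> exists y, T ^+ i *m u = U *m y) ->
  (size f <= k.+1)%N -> trial_image T U (s *m s^T - s' *m s'^T).
Proof.
move=> TT Uu sf.
have vS i : T *m (T ^+ i *m u) = T ^+ i.+1 *m u by rewrite exprS -mulmxA.
have Es : s = \sum_(i < k.+1) f`_i *: (T ^+ i *m u).
  rewrite /s (horner_mx_wide _ sf) mulmx_suml.
  by apply: eq_bigr => i _; rewrite -scalemxAl.
have Es' : s' = \sum_(i < k.+1) ((-1) ^+ i * f`_i) *: (T ^+ i *m u).
  rewrite /s' (horner_mx_wide _ (k := k.+1)) ?mulmx_suml.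
    by apply: eq_bigr => i _; rewrite -scalemxAl coef_comp_polyNX.
  by rewrite size_comp_poly2 // size_polyN size_polyX.
by rewrite Es Es'; exact: (trial_image_parity TT vS Uu (fun i => f`_i)).
Qed.

(** * Symmetric matrices as weighted sums over their spectrum *)

Section SpectralMeasure.
Context {R : realType}.
Local Notation cx := (real_complex R).

Lemma map_real_hermitian n (T : 'M[R]_n) : T^T = T -> map_mx cx T \is hermsymmx.
Proof.
move=> TT; apply/is_hermitianmxP; rewrite expr0 scale1r.
by apply/matrixP => i j; rewrite -[in LHS]TT !mxE; exact/esym/conjc_real.
Qed.

(** The spectral theorem in the form used below: the quadratic form of [g(T)] at
    [x] is the integral of [g] against a measure on the spectrum that does not
    depend on [g].  The weights are the squared moduli of the coordinates of [x]
    in a complex orthonormal eigenbasis. *)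
Lemma spectral_measure n (T : 'M[R]_n.+1) (x : 'cV[R]_n.+1) : T^T = T ->
  exists d w : 'I_n.+1 -> R,
    [/\ forall i, eigenvalue T (d i), forall i, 0 <= w i
      & forall g, mxdot x (horner_mx T g *m x) = \sum_i g.[d i] * w i].
Proof.
move=> TT; have Th := map_real_hermitian TT.
set TC := map_mx cx T in Th.
pose P := spectralmx TC; pose D := spectral_diag TC.
have Pu : P \in unitmx := spectral_unit TC.
have DE : TC = invmx P *m diag_mx D *m P.
  exact/orthomx_spectralP/hermitian_normalmx.
have /mxOverP Dreal := hermitian_spectral_diag_real Th.
have Dd i : cx (complex.Re (D 0 i)) = D 0 i by exact/RRe_real/Dreal.
pose y := P *m map_mx cx x.
exists (fun i => complex.Re (D 0 i)), (fun i => normc (y i 0) ^+ 2); split.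
- move=> i; rewrite -(eigenvalue_map cx) [X in eigenvalue _ X]Dd -/TC.
  apply/eigenvalueP.
  exists (row i P); last first.
    apply/eqP => Pi0; have /rowP/(_ i) : row i (P *m invmx P) = 0.
      by rewrite row_mul Pi0 mul0mx.
    by rewrite mulmxV // !mxE eqxx => /eqP; rewrite oner_eq0.
  by rewrite DE -row_mul !mulmxA mulmxV // mul1mx row_mul row_diag_mx -scalemxAl
    -rowE.
- by move=> i; rewrite sqr_ge0.
move=> g; apply: (@complexI R).
rewrite mxdot_cV.
have -> : cx ((x^T *m (horner_mx T g *m x)) 0 0)
    = (map_mx cx (x^T *m (horner_mx T g *m x))) 0 0 by rewrite [RHS]mxE.
rewrite !map_mxM map_horner_mx -/TC DE horner_mx_uconjC // horner_mx_diag.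
rewrite !mulmxA -/y.
have -> : map_mx cx x^T *m invmx P = (map_mx conjc y)^T.
  rewrite invmx_unitary ?spectral_unitarymx // /y map_mxM trmx_mul.
  congr (_ *m _); apply/matrixP => i j; rewrite !mxE //.
  exact/esym/conjc_real.
rewrite -mulmxA -/y mul_mx_diag mxE rmorph_sum; apply: eq_bigr => i _.
rewrite !mxE rmorphM -(horner_map cx) /= Dd -mulrA mulrCA; congr (_ * _).
by rewrite rmorphXn /= mulrC -sqr_normc.
Qed.

End SpectralMeasure.

Section Rayleigh.
Context {R : realType} {n : nat}.
Variable T : 'M[R]_n.+1.
Hypothesis T_sym : T^T = T.

Lemma spectral_ineq (f g : {poly R}) (x : 'cV[R]_n.+1) :
  (forall t, eigenvalue T t -> f.[t] <= g.[t]) ->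
  mxdot x (horner_mx T f *m x) <= mxdot x (horner_mx T g *m x).
Proof.
move=> fg; have [d [w [Td w0 E]]] := spectral_measure x T_sym.
by rewrite !E; apply: ler_sum => i _; rewrite ler_wpM2r // fg.
Qed.

Lemma horner_mx_sym (f : {poly R}) : (horner_mx T f)^T = horner_mx T f.
Proof.
rewrite (horner_mx_wide _ (leqnn _)) linear_sum; apply: eq_bigr => i _.
rewrite linearZ /=; congr (_ *: _); elim: (i : nat) => [|j IH].
  by rewrite expr0 trmx1.
by rewrite {1}exprS exprSr trmx_mul IH T_sym.
Qed.

Lemma mxdot_horner (f : {poly R}) (x : 'cV[R]_n.+1) :
  mxdot (horner_mx T f *m x) (horner_mx T f *m x) =
  mxdot x (horner_mx T (f ^+ 2) *m x).
Proof.
by rewrite expr2 rmorphM /= -mulmxA mxdot_adjl horner_mx_sym mxdotC.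
Qed.

Lemma horner_mx_unit (f : {poly R}) :
  (forall t, eigenvalue T t -> f.[t] != 0) -> horner_mx T f \in unitmx.
Proof.
move=> f0; rewrite -unitmx_tr -row_free_unit; apply/inj_row_free => v vf0.
have {vf0} fx0 : horner_mx T f *m v^T = 0.
  by apply: trmx_inj; rewrite trmx_mul trmxK vf0 trmx0.
have [d [w [Td w0 E]]] := spectral_measure v^T T_sym.
have := mxdot_horner f v^T; rewrite fx0 mxdot0r E => /esym/eqP.
rewrite psumr_eq0 => [/allP w00|i _]; last first.
  by rewrite horner_exp mulr_ge0 ?sqr_ge0.
apply: trmx_inj; rewrite trmx0; apply/eqP; rewrite -mxdot_eq0.
(* All weights vanish, and for [g = 1] they add up to the squared norm. *)
have := E 1; rewrite rmorph1 mul1mx => ->; apply/eqP/big1 => i _.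
have := w00 i (mem_index_enum i); rewrite /= horner_exp mulf_eq0 expf_eq0 /=.
by rewrite (negPf (f0 _ (Td i))) => /eqP->; rewrite mulr0.
Qed.

Lemma eigenvalue_rayleigh t : eigenvalue T t ->
  exists2 x : 'cV[R]_n.+1, 0 < mxdot x x & mxdot x (T *m x) = t * mxdot x x.
Proof.
move=> /eigenvalueP[v vT v0]; exists v^T.
  by rewrite lt0r mxdot_ge0 mxdot_eq0 -trmx0 (inj_eq (@trmx_inj _ _ _)) v0.
by rewrite -[T in T *m _]T_sym -trmx_mul vT linearZ /= mxdotZr.
Qed.

Lemma rayleigh_lower l : (forall t, eigenvalue T t -> l <= t) ->
  rayleigh_lb T l.
Proof.
move=> lT x; have := @spectral_ineq l%:P 'X x.
rewrite horner_mx_C horner_mx_X mul_scalar_mx mxdotZr; apply=> t /lT.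
by rewrite hornerC hornerX.
Qed.

Lemma rayleigh_upper l : (forall t, eigenvalue T t -> t <= l) ->
  forall x : 'cV_n.+1, mxdot x (T *m x) <= l * mxdot x x.
Proof.
move=> lT x; have := @spectral_ineq 'X l%:P x.
rewrite horner_mx_C horner_mx_X mul_scalar_mx mxdotZr; apply=> t /lT.
by rewrite hornerC hornerX.
Qed.

End Rayleigh.

Section PolePolynomial.
Context {R : realType}.
Local Notation cx := (real_complex R).

(** The Galerkin argument takes place in real matrices, so the pole polynomial
    is needed with real coefficients. *)
Lemma real_pole_poly (xi : seq R[i]) : conj_closed xi ->
  exists q : {poly R}, map_poly cx q = pole_poly xi.
Proof.
move=> xiJ; have qJ : map_poly (@conjc R) (pole_poly xi) = pole_poly xi.
  rewrite {1}/pole_poly rmorph_prod /=.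
  under eq_bigr => z _ do rewrite rmorphB /= map_polyX map_polyC /=.
  rewrite -(big_map (@conjc R) xpredT (fun z => 'X - z%:P)).
  exact: perm_big.
exists (map_poly (@complex.Re R) (pole_poly xi)).
apply/polyP => i; rewrite !coef_map_id0 //; apply: RRe_real.
by apply/CrealP; rewrite -[in RHS]qJ coef_map_id0 // conjc0.
Qed.

Lemma size_pole_poly (xi : seq R[i]) : size (pole_poly xi) = (size xi).+1.
Proof. by rewrite /pole_poly size_prod_XsubC. Qed.

Lemma normc_pole_poly (xi : seq R[i]) (z : R[i]) :
  normc (pole_poly xi).[z] ^+ 2 = \prod_(x <- xi) normc (z - x) ^+ 2.
Proof.
rewrite /pole_poly horner_prod; elim: xi => [|x s IH].
  by rewrite !big_nil normc1 expr1n.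
by rewrite !big_cons normcM exprMn IH hornerXsubC.
Qed.

Lemma normc_real (x : R) : normc x%:C ^+ 2 = x ^+ 2.
Proof. by rewrite normc_sqr /= expr0n addr0. Qed.

Lemma real_pole_poly_neq0 (xi : seq R[i]) (q : {poly R}) t :
  map_poly cx q = pole_poly xi -> t%:C \notin xi -> q.[t] != 0.
Proof.
move=> qE; apply: contra => /eqP qt0.
by rewrite -root_prod_XsubC -/(pole_poly xi) -qE rootE horner_map qt0 rmorph0.
Qed.

(** On the real line [|z + conj x| = |- z - x|], so the numerator of the ratio
    is the squared modulus of the pole polynomial at [- z]. *)
Lemma h_ratio_poly (xi : seq R[i]) (q : {poly R}) z :
  map_poly cx q = pole_poly xi -> h_ratio xi z = q.[- z] ^+ 2 / q.[z] ^+ 2.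
Proof.
move=> qE; rewrite /h_ratio -normc_pole_poly -qE horner_map normc_real.
congr (_ / _); rewrite -normc_real -(horner_map cx) qE normc_pole_poly.
apply: eq_bigr => x _; congr (_ ^+ 2).
by case: x => u v /=; congr Num.sqrt; ring.
Qed.

End PolePolynomial.

(** * Orthonormality of the Lanczos basis *)

Section Lanczos.
Context {R : realType} {N : nat}.
Variables (A : 'M[R]_N) (c : 'cV[R]_N).
Hypothesis A_sym : A^T = A.

Let q := lanczos_q A c.
Let b := lanczos_beta A c.

Lemma lanczos_state_next j : (lanczos_state A c j).1.2 = q j.+1.
Proof.
rewrite /q /lanczos_q /lanczos_state iterS.
by case: (iter _ _ _) => -[].
Qed.

Lemma lanczos_recurrence j : exists w : 'cV[R]_N,
  [/\ b j.+1 = norm2 w, q j.+2 = (b j.+1)^-1 *: w &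
    w = A *m q j.+1 - b j *: q j -
        mxdot (q j.+1) (A *m q j.+1 - b j *: q j) *: q j.+1].
Proof.
rewrite -(lanczos_state_next j.+1) -(lanczos_state_next j).
rewrite /b /lanczos_beta /q /lanczos_q {1 2 3}/lanczos_state iterS.
rewrite -/(lanczos_state _ _ _).
case: (lanczos_state A c j) => -[qp q0] bp /=.
by eexists; split; [reflexivity|reflexivity|rewrite mxdot_cV].
Qed.

(** In the induction step [q_k^T A q_n] is computed by moving [A] to [q_k] and
    applying the recurrence there: for [k < n] it is [b_k] if [k + 1 = n] and
    zero otherwise, which is what the term in [q_(n-1)] of the recurrence
    removes.  Including the index 0, where [q_0 = 0], avoids a separate
    treatment of the first steps. *)
Lemma lanczos_orthonormal_seq M : no_breakdown A c M ->
  forall i j, (i <= M)%N -> (j <= M)%N ->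
    mxdot (q i) (q j) = ((i == j) && (0 < i)%N)%:R.
Proof.
move=> [c0 bn0].
have q0 : q 0 = 0 by [].
have normalize (w : 'cV[R]_N) : norm2 w != 0 ->
    mxdot ((norm2 w)^-1 *: w) ((norm2 w)^-1 *: w) = 1.
  move=> w0; rewrite mxdotZl mxdotZr -frobenius_sqr -/(norm2 w).
  by rewrite expr2 mulKf // mulVf.
have q1 : mxdot (q 1) (q 1) = 1 by exact: normalize.
suff H n : (n <= M)%N -> forall i j, (i <= n)%N -> (j <= n)%N ->
    mxdot (q i) (q j) = ((i == j) && (0 < i)%N)%:R by move=> i j; exact: (H M).
elim: n => [|n IH] ltnM i j.
  by rewrite !leqn0 => /eqP-> /eqP->; rewrite q0 mxdot0r.
have {}IH := IH (ltnW ltnM).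
suff new k : (k <= n)%N -> mxdot (q k) (q n.+1) = 0 /\
    mxdot (q n.+1) (q n.+1) = 1.
  have [_ new1] := new 0 (leq0n n).
  case: (ltngtP i n.+1) => // [lei|->] _;
    case: (ltngtP j n.+1) => // [lej|->] _.
  - exact: IH.
  - by rewrite (new i lei).1 ltn_eqF.
  - by rewrite mxdotC (new j lej).1.
  - by rewrite new1.
case: n IH ltnM {i j} => [_ _|n IH ltnM lek].
  by rewrite leqn0 => /eqP->; rewrite q0 mxdotC mxdot0r.
have rec j : (j < M)%N ->
    b j.+1 *: q j.+2 = A *m q j.+1 - b j *: q j -
      mxdot (q j.+1) (A *m q j.+1 - b j *: q j) *: q j.+1.
  move=> ltj; have [w [bw -> <-]] := lanczos_recurrence j.
  by rewrite scalerA divff ?scale1r // bn0.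
have ltnM' : (n < M)%N by exact: ltnW.
have bn : b n.+1 != 0 by rewrite bn0.
split; last first.
  have [w [bw -> _]] := lanczos_recurrence n.
  by rewrite bw normalize // -bw.
apply: (mulfI bn); rewrite mulr0 -mxdotZr rec //.
case: k lek => [_|k lek]; first by rewrite q0 mxdotC mxdot0r.
rewrite mxdotBr mxdotZr IH //.
have [->|kn] := eqVneq k.+1 n.+1; first by rewrite mulr1 subrr.
rewrite mulr0 subr0 mxdotBr mxdotZr mxdot_adjl A_sym.
have ltkn : (k < n)%N by rewrite -ltnS ltn_neqAle kn.
have -> : A *m q k.+1 = b k.+1 *: q k.+2 + b k *: q k +
    mxdot (q k.+1) (A *m q k.+1 - b k *: q k) *: q k.+1.
  by rewrite rec ?(ltn_trans ltkn) // addrAC subrK addrAC addrK ?subrK.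
have k2 : (k.+2 <= n.+1)%N by []; have k1 := ltnW k2; have k0 := ltnW k1.
rewrite !mxdotDl !mxdotZl !IH //.
rewrite (negPf kn) mulr0 addr0 /= andbT.
rewrite (ltn_eqF (_ : k < n.+1)%N) ?mulr0 ?addr0; last by rewrite ltnW.
rewrite eqSS; have [->|] := eqVneq k.+1 n; first by rewrite subrr.
by rewrite !mulr0 subrr.
Qed.

Lemma lanczosQ_orthonormal M : no_breakdown A c M ->
  (lanczosQ A c M)^T *m lanczosQ A c M = 1%:M.
Proof.
move=> nb; apply/matrixP => i j; rewrite [RHS]mxE.
transitivity (mxdot (q i.+1) (q j.+1)).
  by rewrite mxdot_cV !mxE; apply: eq_bigr => k _; rewrite !mxE.
by rewrite (lanczos_orthonormal_seq nb) // andbT eqSS.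
Qed.

End Lanczos.

(** * The error bound *)

(** An eigenvalue of the compression is the Rayleigh quotient of [A] at [Q x],
    where [x] is an eigenvector. *)
Lemma projected_eigenvalue (R : realType) N n (A : 'M[R]_N.+1)
    (Q : 'M[R]_(N.+1, n.+1)) lmin lmax :
  A^T = A -> Q^T *m Q = 1%:M ->
  smallest_eigenvalue A lmin -> largest_eigenvalue A lmax ->
  forall t, eigenvalue (Q^T *m A *m Q) t -> lmin <= t <= lmax.
Proof.
move=> AA QQ [_ minA] [_ maxA] t Tt.
have [|x x0 xT] := eigenvalue_rayleigh _ Tt.
  by rewrite !trmx_mul trmxK AA mulmxA.
have xE : mxdot (Q *m x) (A *m (Q *m x)) = t * mxdot (Q *m x) (Q *m x).
  have -> : mxdot (Q *m x) (Q *m x) = mxdot x x.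
    by rewrite mxdot_adjl mulmxA QQ mul1mx.
  by rewrite -xT -!mulmxA [RHS]mxdot_adjl trmxK.
have Qx0 : 0 < mxdot (Q *m x) (Q *m x).
  by rewrite mxdot_adjl mulmxA QQ mul1mx.
rewrite -(ler_pM2r Qx0) -[X in _ && X](ler_pM2r Qx0) -xE.
by rewrite rayleigh_lower // rayleigh_upper.
Qed.

(** This is [|r(T) b|^2 <= h |b|^2] for [r(z) = q(-z) / q(z)] and [b = q(T) u],
    freed from the inverse of [q(T)]: on the spectrum of [T] the polynomial
    [q(-z)^2] is at most [h q(z)^2]. *)
Lemma pole_quotient_bound (R : realType) n (T : 'M[R]_n.+1) (xi : seq R[i])
    (q : {poly R}) lmin lmax (u : 'cV[R]_n.+1) :
  T^T = T -> map_poly (real_complex R) q = pole_poly xi ->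
  lmin <= lmax -> (forall t, lmin <= t <= lmax -> t%:C \notin xi) ->
  (forall t, eigenvalue T t -> lmin <= t <= lmax) ->
  mxdot (horner_mx T (q \Po (- 'X)) *m u) (horner_mx T (q \Po (- 'X)) *m u) <=
  h xi lmin lmax * mxdot (horner_mx T q *m u) (horner_mx T q *m u).
Proof.
move=> TT qE lle nxi Tlm.
rewrite !mxdot_horner // -mxdotZr scalemxAl -horner_mxZ.
apply: spectral_ineq => // t /Tlm tlm.
have [_ /(_ t tlm)] := h_max lle nxi.
rewrite (h_ratio_poly _ qE) hornerZ !horner_exp horner_comp hornerN hornerX.
rewrite ler_pdivrMr // lt0r sqr_ge0 andbT expf_eq0 /=.
exact: real_pole_poly_neq0 (nxi t tlm).
Qed.

Lemma rational_krylovX (R : realType) n (T : 'M[R]_n.+1) (b : 'cV[R]_n.+1)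
    (xi : seq R[i]) (q : {poly R}) i :
  map_poly (real_complex R) q = pole_poly xi -> (i < size xi)%N ->
  rational_krylov T b xi (T ^+ i *m (invmx (horner_mx T q) *m b)).
Proof.
move=> qE lti; exists 'X^i; split; first by rewrite size_polyXn.
have -> : T ^+ i = horner_mx T 'X^i by rewrite rmorphXn /= horner_mx_X.
by rewrite !map_mxM map_invmx !map_horner_mx qE mulmxA.
Qed.

Theorem corollary2p3 (R : realType) (N m k : nat) (A : 'M[R]_N) (c : 'cV[R]_N)
    (lmin lmax : R) (xi : k.-tuple R[i]) (X Xlan Xref : 'M[R]_N) :
  posdefmx A ->
  smallest_eigenvalue A lmin ->
  largest_eigenvalue A lmax ->
  lyapunov_solution A (c *m c^T) X ->
  (m.+1 < N)%N ->
  no_breakdown A c m.+1 ->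
  conj_closed xi ->
  (forall t : R, lmin <= t <= lmax -> t%:C \notin xi) ->
  lanczos_approx A c m Xlan ->
  reference_approx A c m xi Xref ->
  frobenius (X - Xref) <=
    frobenius (X - Xlan) + h xi lmin lmax / lmin * norm2 c ^+ 2.
Proof.
case: N A c X Xlan Xref => // N A c X Xlan Xref.
move=> [A_sym Apos] minA maxA _ _ nb xiJ nxi [Z [ZB ->]].
move=> [U [Y [[UU UV] YB ->]]].
set Q := lanczosQ A c m.+1 in ZB YB *.
set T := lanczosT A c m.+1 in ZB YB UV.
have QQ : Q^T *m Q = 1%:M := lanczosQ_orthonormal A_sym nb.
have T_sym : T^T = T by rewrite /T /lanczosT !trmx_mul trmxK A_sym mulmxA.
have Tlm : forall t, eigenvalue T t -> lmin <= t <= lmax.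
  exact: projected_eigenvalue A_sym QQ minA maxA.
have lle : lmin <= lmax by apply: minA.2; exact: maxA.1.
have lmin0 : 0 < lmin.
  have [x x0 xA] := eigenvalue_rayleigh A_sym minA.1.
  have := Apos x; rewrite -mulmxA -mxdot_cV xA pmulr_lgt0 //; apply.
  by rewrite -mxdot_eq0 gt_eqF.
have [q qE] := real_pole_poly xiJ.
have qT : horner_mx T q \in unitmx.
  by apply: horner_mx_unit => // t /Tlm/nxi/(real_pole_poly_neq0 qE).
pose u := invmx (horner_mx T q) *m e1 R m.
have qu : horner_mx T q *m u = e1 R m by rewrite mulKVmx.
have e11 : mxdot (e1 R m) (e1 R m) = 1.
  by rewrite mxdot_cV /e1 trmx_delta mul_delta_mx mxE !eqxx.
pose s := horner_mx T (q \Po (- 'X)) *m u.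
have sh : mxdot s s <= h xi lmin lmax.
  by have := pole_quotient_bound u T_sym qE lle nxi Tlm; rewrite qu e11 mulr1.
have h0 : 0 <= h xi lmin lmax := le_trans (mxdot_ge0 s) sh.
(* The trial solution: its residual is the multiple of [s s^T]. *)
have [W WB] : trial_image T U (norm2 c ^+ 2 *: (e1 R m *m (e1 R m)^T)
    - norm2 c ^+ 2 *: (s *m s^T)).
  rewrite -scalerBr -qu; apply/trial_imageZ/trial_image_rank1 => //.
    move=> i lti; have : rational_krylov T (e1 R m) xi (T ^+ i *m u).
      by apply: rational_krylovX => //; rewrite size_tuple.
    by rewrite UV => -[y _ <-]; exists y.
  by rewrite -(size_map_poly (real_complex R)) qE size_pole_poly size_tuple.
have Tl : rayleigh_lb T lmin.
  by apply: rayleigh_lower => // t /Tlm/andP[].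
have YB' : lyap (U^T *m T *m U) Y =
    U^T *m (norm2 c ^+ 2 *: (e1 R m *m (e1 R m)^T)) *m U.
  by rewrite /lyap YB trmx_mul trmxK -scalemxAr -scalemxAl !mulmxA.
have := galerkin_error T_sym lmin0 Tl UU ZB YB' WB.
rewrite frobeniusZ ?sqr_ge0 // frobenius_rank1 => err.
rewrite -[X in X - _](subrK (Q *m Z *m Q^T)) -addrA.
apply: le_trans (frobeniusD _ _) _; rewrite lerD2l.
have -> : Q *m Z *m Q^T - Q *m U *m Y *m (Q *m U)^T =
    Q *m (Z - U *m Y *m U^T) *m Q^T.
  by rewrite mulmxBr mulmxBl trmx_mul !mulmxA.
rewrite frobenius_isometry //; apply: le_trans err _.
have -> : h xi lmin lmax / lmin * norm2 c ^+ 2 =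
    norm2 c ^+ 2 * (2 * h xi lmin lmax) / (2 * lmin).
  by field; rewrite gt_eqF.
rewrite ler_pM2r ?invr_gt0 ?mulr_gt0 // ler_wpM2l ?sqr_ge0 //.
by rewrite (le_trans sh) // ler_peMl // ler1n.
Qed.
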